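(* Consider a benchmark dataset such that for every prompt $s_q$ in the support of $P_Q$ the set of correct outputs $\textsc{c}(s_q)$ consists of exactly one sequence, which is a single-token sequence. Let $m$ be a large language model that (for every prompt) assigns positive probability to every single-token sequence and zero probability to any other sequence. If the sampling mechanism defined by $f_T$ and $P_U$ is given by the Gumbel-Max SCM, then there exists a constant $\varepsilon(m)>0$ such that, for every large language model $m'$ that assigns positive probability to every single-token sequence and zero probability to any other sequence and satisfies $$d(m,m')=\sup_{s_q}\big\|f_D(s_q,m)-f_D(s_q,m')\big\|_\infty<\varepsilon(m),$$ it holds that $$\mathrm{Var}\big[R_m(\mathbf{U},S_q)-R_{m'}(\mathbf{U}',S_q)\big] > \mathrm{Var}\big[R_m(\mathbf{U},S_q)-R_{m'}(\mathbf{U},S_q)\big],$$ where $S_q\sim P_Q$ and $\mathbf{U},\mathbf{U}'\sim P_{\mathbf{U}}$ are mutually independent.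
   Context: $V$ is a finite vocabulary of tokens with $|V|\ge 2$, $V^*$ the finite set of token sequences of length at most $K$, and $P_Q$ a distribution of prompts on $V^*$; the supremum over $s_q$ ranges over all prompts in $V^*$. A model $m$ maps a sequence $s$ to a next-token distribution $f_D(s,m)\in\Delta(V)$. The noise sequence is $\mathbf{U}=(U_1,\dots,U_K)$ with i.i.d. entries $U_i\sim P_U$; its law is $P_{\mathbf{U}}$. Gumbel-Max SCM: each $U_i=(U_{i,t})_{t\in V}$ has i.i.d. components $U_{i,t}\sim\mathrm{Gumbel}(0,1)$, and $f_T(D_i,U_i)=\operatorname{argmax}_{t\in V}\{\log(D_{i,t})+U_{i,t}\}$. For models that only output single-token sequences, the output on prompt $s_q$ under noise $\mathbf{u}$ is the single token $S_m(\mathbf{u},s_q)=f_T(f_D(s_q,m),u_1)$, so the probability that $m$ assigns to the single-token sequence $t$ on $s_q$ is $[f_D(s_q,m)]_t$. The score is $R_m(\mathbf{u},s_q)=\mathbf{1}\{S_m(\mathbf{u},s_q)\in\textsc{c}(s_q)\}\in\{0,1\}$. *)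

(* Defs.v *)
From HB Require Import structures.
From mathcomp Require Import all_boot all_order all_algebra.
From mathcomp Require Import all_classical all_reals all_analysis.

Set Implicit Arguments.
Unset Strict Implicit.
Unset Printing Implicit Defensive.

Import Order.TTheory GRing.Theory Num.Theory.
Import numFieldNormedType.Exports.

Local Open Scope classical_set_scope.
Local Open Scope ring_scope.

Record fdist (R : realType) (T : finType) := FDist {
  fdist_fun :> T -> R;
  fdist_ge0 : forall x, 0 <= fdist_fun x;
  fdist_sum1 : \sum_x fdist_fun x = 1 }.

(* The maximal length, and the number of noise entries, is [K.+1]: it is      *)
(* positive because the output uses the first noise entry.                    *)
Definition token_seq (V : finType) (K : nat) : finType := K.+1.-bseq V.

Definition single_token (V : finType) (K : nat) (t : V) : token_seq V K :=
  [bseq t].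

(* A model is identified with its next-token map [f_D(., m)].                 *)
Definition llm (R : realType) (V : finType) (K : nat) :=
  token_seq V K -> fdist R V.

Definition fD (R : realType) (V : finType) (K : nat)
  (s : token_seq V K) (m : llm R V K) : fdist R V := m s.

Definition dist_llm (R : realType) (V : finType) (K : nat)
    (m m' : llm R V K) : R :=
  \big[Num.max/0]_(s : token_seq V K)
    \big[Num.max/0]_(t : V) `|fD s m t - fD s m' t|.

(* Probability that the output on prompt [s] is the sequence [w], for a model *)
(* whose output is a single token drawn from [f_D(s, m)].                     *)
Definition output_prob (R : realType) (V : finType) (K : nat)
    (m : llm R V K) (s w : token_seq V K) : R :=
  \sum_(t | single_token K t == w) fD s m t.

(* Outputs consist of one token by construction, so the content of this       *)
(* predicate is its first clause, i.e. [0 < fD s m t] for all [s] and [t].     *)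
Definition single_token_model (R : realType) (V : finType) (K : nat)
    (m : llm R V K) : Prop :=
  (forall s t, 0 < output_prob m s (single_token K t)) /\
  (forall s w, (forall t, w <> single_token K t) -> output_prob m s w = 0).

Definition noise (R : realType) (V : finType) (K : nat) :=
  'I_K.+1 -> V -> R.

Definition some_token (V : finType) (V_gt1 : (1 < #|V|)%N) : V :=
  enum_val (Ordinal (ltnW V_gt1)).

(* [arg max] ranges over all of [V]: its value does not depend on the starting *)
(* point [some_token V_gt1], and ties are broken by a fixed choice.  The       *)
(* logarithm is taken in [\bar R], so that [log 0 = -oo] ([ln 0] is [0]).      *)
Definition gumbel_max (R : realType) (V : finType) (V_gt1 : (1 < #|V|)%N)
    (D : fdist R V) (u : V -> R) : V :=
  [arg max_(t > some_token V_gt1) (lne (D t)%:E + (u t)%:E)%E]%O.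

Definition output_token (R : realType) (V : finType) (V_gt1 : (1 < #|V|)%N)
    (K : nat) (m : llm R V K) (u : noise R V K) (s : token_seq V K) : V :=
  gumbel_max V_gt1 (fD s m) (u ord0).

Definition score (R : realType) (V : finType) (V_gt1 : (1 < #|V|)%N)
    (K : nat) (c : token_seq V K -> {set token_seq V K})
    (m : llm R V K) (u : noise R V K) (s : token_seq V K) : R :=
  (single_token K (output_token V_gt1 m u s) \in c s)%:R.

Definition mutually_independent (R : realType) (d : measure_display)
    (Omega : measurableType d) (P : probability Omega R)
    (I : finType) (F : I -> set (set Omega)) : Prop :=
  forall (J : {set I}) (A : I -> set Omega),
    (forall i, i \in J -> F i (A i)) ->
    P (\bigcap_(i in [set` J]) A i) = (\prod_(i in J) P (A i))%E.

Definition sigma_rv (R : realType) (d : measure_display)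
    (Omega : measurableType d) (X : Omega -> R) : set (set Omega) :=
  preimage_set_system setT X measurable.

Definition sigma_rvs (R : realType) (d : measure_display)
    (Omega : measurableType d) (I : Type) (X : I -> Omega -> R) :
    set (set Omega) :=
  <<s \bigcup_i sigma_rv (X i) >>.

Definition sigma_discrete (d : measure_display)
    (Omega : measurableType d) (T : Type) (X : Omega -> T) : set (set Omega) :=
  preimage_set_system setT X setT.

Definition standard_gumbel (R : realType) (d : measure_display)
    (Omega : measurableType d) (P : probability Omega R)
    (X : {RV P >-> R}) : Prop :=
  forall x : R, cdf X x = (expR (- expR (- x)))%:E.

(* The entries [U i] are independent vectors, each with independent            *)
(* components; having a common marginal law, they are then i.i.d.              *)
Definition gumbel_noise (R : realType) (d : measure_display)
    (Omega : measurableType d) (P : probability Omega R)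
    (V : finType) (K : nat) (U : 'I_K.+1 -> V -> {RV P >-> R}) : Prop :=
  [/\ forall i t, standard_gumbel (U i t),
      forall i, mutually_independent P (fun t => sigma_rv (U i t)) &
      mutually_independent P (fun i => sigma_rvs (fun t => U i t))].

Definition prompt_law (R : realType) (d : measure_display)
    (Omega : measurableType d) (P : probability Omega R) (T : finType)
    (PQ : fdist R T) (S : Omega -> T) : Prop :=
  forall s, measurable (S @^-1` [set s]) /\ P (S @^-1` [set s]) = (PQ s)%:E.

Definition independent_prompt_noises (R : realType) (d : measure_display)
    (Omega : measurableType d) (P : probability Omega R)
    (V : finType) (K : nat) (S : Omega -> token_seq V K)
    (U U' : 'I_K.+1 -> V -> {RV P >-> R}) : Prop :=
  mutually_independent P (tnth [tuple
    sigma_discrete S;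
    sigma_rvs (fun it : 'I_K.+1 * V => U it.1 it.2);
    sigma_rvs (fun it : 'I_K.+1 * V => U' it.1 it.2)]).

Definition noise_at (R : realType) (d : measure_display)
    (Omega : measurableType d) (P : probability Omega R)
    (V : finType) (K : nat) (U : 'I_K.+1 -> V -> {RV P >-> R})
    (w : Omega) : noise R V K :=
  fun i t => U i t w.

(* Main.v *)
Require Import Defs.
From HB Require Import structures.
From mathcomp Require Import all_boot all_order all_algebra.
From mathcomp Require Import all_classical all_reals all_analysis.
From mathcomp Require Import measurable_realfun ring lra.

Set Implicit Arguments.

Import Order.TTheory GRing.Theory Num.Theory.
Import numFieldNormedType.Exports.

Local Open Scope classical_set_scope.
Local Open Scope ring_scope.

(** Both differences have the same marginals, so the claim is that the two
    scores are more positively correlated under shared noise.  Conditionally on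
    a prompt with correct token [t], write [a_j = D_j / D_t] and
    [b_j = D'_j / D'_t].  By the Gumbel race, both models output [t] under
    shared noise with probability [1 / (1 + \sum_(j != t) max (a_j, b_j))],
    against [1 / ((1 + \sum_(j != t) a_j) (1 + \sum_(j != t) b_j))] under
    independent noise.  The former is larger because [max (a_j, b_j) <= a_j + b_j]
    and the cross terms are positive, whatever the distance between the two
    models: [eps = 1] works.

    The race probability itself is obtained without integration.  If [X] and [Y]
    are independent with distribution functions [exp (- a e^-x)] and
    [exp (- b e^-y)], summing [P (X \in ]x, x'], Y <= x)] over a grid on which
    [e^-x] is regular is a geometric sum that gives [P (Y < X) >= a / (a + b)]
    as the mesh vanishes; exchanging [X] and [Y] gives the upper bound and shows
    that ties are negligible. *)

(** * Race between two independent variables *)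

(* The mesh [h] tends to 0 and [N h] to infinity. *)
Lemma exp_race_limit (R : realType) (a b p : R) : 0 < a -> 0 < b ->
  (forall (h : R) (N : nat), 0 < h ->
    expR (- (b * h)) * (1 - expR (- (a * h))) *
    (expR (- ((a + b) * h)) - expR (- ((a + b) * h)) ^+ N.+1)
      <= (1 - expR (- ((a + b) * h))) * p) ->
  a / (a + b) <= p.
Proof.
move=> a0 b0 H; set c := a + b in H *.
have c0 : 0 < c by rewrite addr_gt0.
rewrite ler_pdivrMr//; apply/ler_addgt0Pr => e e0.
(* The error [e] is split in two: with [r = expR (- (c * h))], this [h] gives
   [r * r >= 1 - e / (2 * a)], and [N] below gives [r ^+ N <= e / (2 * a)]; multiplied by [a], the
   two losses add up to [e]. *)
have [h hE] : exists h : R, h = e / (4 * a * c) by eexists.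
have h0 : 0 < h by rewrite hE divr_gt0// !mulr_gt0.
have ch0 : 0 < c * h := mulr_gt0 c0 h0.
have ah0 : 0 < a * h := mulr_gt0 a0 h0.
(* At [N = 0] the geometric sum is empty, so the hypothesis reads [0 <= (1 - r) * p]. *)
have p0 : 0 <= p.
  have r1 : 0 < 1 - expR (- (c * h)) by rewrite subr_gt0 expR_lt1 oppr_lt0 mulr_gt0.
  by have := H h 0%N h0; rewrite expr1 subrr mulr0 pmulr_rge0.
pose N := Num.bound (2 * a / (e * (c * h))).
have q0 : 0 < 2 * a / (e * (c * h)) by apply: divr_gt0;
  [exact: mulr_gt0|apply: mulr_gt0 => //; exact: mulr_gt0].
have hN : 2 * a / (e * (c * h)) < N%:R := archi_boundP (ltW q0).
have N0 : 0 < N%:R :> R := lt_trans q0 hN.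
have ea : 1 - expR (- (a * h)) >= (a * h) * expR (- (a * h)).
  have := expR_ge1Dx (a * h); rewrite -(ler_pM2r (expR_gt0 (- (a * h)))).
  by rewrite -expRD subrr expR0 mulrDl mul1r => ?; lra.
have ec : 1 - expR (- (c * h)) <= c * h by have := expR_ge1Dx (- (c * h)); lra.
have hrN : expR (- (c * h)) ^+ N <= (c * h * N%:R)^-1.
  rewrite -expRM_natl mulrN expRN lef_pV2 ?posrE ?mulr_gt0 ?divr_gt0 ?expR_gt0//.
  by rewrite mulrC; apply: le_trans (expR_ge1Dx _); rewrite lerDr.
have e2 : 1 - 2 * (c * h) <= expR (- (c * h)) * expR (- (c * h)).
  by rewrite -expRD; have := expR_ge1Dx (- (c * h) - c * h); lra.
pose r := expR (- (c * h)); rewrite -/r in ec hrN e2.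
have r0 : 0 < r by apply: expR_gt0.
have r1 : r <= 1 by rewrite expR_le1 oppr_le0 mulr_ge0 ?ltW.
have rN : 0 <= 1 - r ^+ N by rewrite subr_ge0 exprn_ile1// ltW.
have := H h N h0; rewrite -/r => HN.
(* Bounding [1 - expR (- (a * h))] below by [a * h * expR (- (a * h))] costs a factor that merges
   with [expR (- (b * h))] into a second [r]. *)
have {HN} HN : c * h * p >= (a * h) * (r * r * (1 - r ^+ N)).
  apply: le_trans (ler_wpM2r p0 ec); apply: le_trans HN.
  have rE : r = expR (- (b * h)) * expR (- (a * h))
    by rewrite -expRD; congr expR; rewrite /c; ring.
  have -> : expR (- (b * h)) * (1 - expR (- (a * h))) * (r - r ^+ N.+1) =
    (expR (- (b * h)) * r * (1 - r ^+ N)) * (1 - expR (- (a * h))).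
    by rewrite exprS; ring.
  rewrite [X in X * r * (1 - _)]rE.
  have -> : a * h * (expR (- (b * h)) * expR (- (a * h)) * r * (1 - r ^+ N)) =
    (expR (- (b * h)) * r * (1 - r ^+ N)) * ((a * h) * expR (- (a * h))) by ring.
  by rewrite ler_wpM2l// !mulr_ge0// ?expR_ge0 ?ltW.
have {HN} HN : a * (r * r * (1 - r ^+ N)) <= p * c.
  rewrite -(ler_pM2r h0); have -> : p * c * h = c * h * p by ring.
  by have -> : a * (r * r * (1 - r ^+ N)) * h = a * h * (r * r * (1 - r ^+ N)) by ring.
have hc : 2 * (c * h) = e / (2 * a) by rewrite hE; field; lra.
have eN2 : (c * h * N%:R)^-1 <= e / (2 * a).
  have a20 : 0 < 2 * a by rewrite mulr_gt0.
  rewrite -[leRHS]invrK invf_div lef_pV2 ?posrE ?divr_gt0 ?(mulr_gt0 ch0)//.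
  move: (ltW hN); rewrite !ler_pdivrMr ?mulr_gt0//.
  by have -> : N%:R * (e * (c * h)) = c * h * N%:R * e by ring.
have ae : a * (e / (2 * a)) = e / 2 by field; lra.
have rr1 : r * r <= 1 by rewrite -expr2 exprn_ile1// ltW.
have rN0 : 0 <= r ^+ N by rewrite exprn_ge0// ltW.
have : 1 - e / (2 * a) - e / (2 * a) <= r * r * (1 - r ^+ N).
  rewrite mulrBr mulr1; have := le_trans hrN eN2; move: e2; rewrite hc.
  move: (e / _) (r ^+ N) (r * r) rN0 rr1 => q z y *.
  have : y * z <= z by rewrite ler_piMl.
  lra.
rewrite -(ler_pM2l a0) => h1.
have := le_trans h1 HN; rewrite !mulrBr mulr1 ae; lra.
Qed.

Lemma measurable_set_le (R : realType) (d : measure_display)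
    (T : measurableType d) (f g : T -> R) :
  measurable_fun setT f -> measurable_fun setT g -> measurable [set w | f w <= g w].
Proof.
by move=> mf mg; rewrite -[X in measurable X]setTI; exact: measurable_fun_le.
Qed.

Lemma measurable_set_lt (R : realType) (d : measure_display)
    (T : measurableType d) (f g : T -> R) :
  measurable_fun setT f -> measurable_fun setT g -> measurable [set w | f w < g w].
Proof.
move=> mf mg; rewrite (_ : [set w | _] = ~` [set w | g w <= f w]).
  by apply: measurableC; exact: measurable_set_le.
by apply/seteqP; split => w /=; rewrite ltNge => /negP.
Qed.

(** The product form of the joint distribution function carries both marginal laws and the
    independence; every cell of the grid has as probability a difference of two of its values. *)
Lemma exp_race_lower (R : realType) (d : measure_display)
    (Omega : measurableType d) (P : probability Omega R) (a b : R)
    (X Y : Omega -> R) : 0 < a -> 0 < b ->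
  measurable_fun setT X -> measurable_fun setT Y ->
  (forall x y, P ([set w | X w <= x] `&` [set w | Y w <= y]) =
    (expR (- (a * expR (- x))) * expR (- (b * expR (- y))))%:E) ->
  ((a / (a + b))%:E <= P [set w | (Y w < X w)%R])%E.
Proof.
move=> a0 b0 mX mY PXY.
have mle (Z : Omega -> R) x : measurable_fun setT Z -> measurable [set w | Z w <= x].
  by move=> mZ; exact: measurable_set_le.
have mYX : measurable [set w | Y w < X w] by exact: measurable_set_lt.
rewrite -(fineK (fin_num_measure P _ mYX)) lee_fin.
apply: exp_race_limit => // h N h0.
(* A regular grid for [expR (- x)]. *)
pose x k : R := - ln (k.+1%:R * h).
have kh0 k : 0 < k.+1%:R * h by rewrite mulr_gt0 ?ltr0n.
have expx k : expR (- x k) = k.+1%:R * h by rewrite opprK lnK ?posrE.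
have xS k : x k.+1 <= x k by rewrite lerN2 ler_ln ?posrE// ler_pM2r// ler_nat leqnSn.
(* The grid points [x k] decrease, so the events [E k] increase inside the event [Y < X]. *)
pose E k := [set w | Y w < X w] `&` ~` [set w | X w <= x k].
have mE k : measurable (E k) by apply: measurableI => //; apply: measurableC; exact: mle.
pose r := expR (- ((a + b) * h)).
pose q := expR (- (b * h)) * (1 - expR (- (a * h))).
have step k : q * r ^+ k.+1 + fine (P (E k)) <= fine (P (E k.+1)).
  (* The cell [x k.+1 < X <= x k], [Y <= x k.+1]: it lies in [E k.+1], is disjoint from [E k], and
     has probability [q * r ^+ k.+1]. *)
  pose F := ([set w | X w <= x k] `&` [set w | Y w <= x k.+1]) `\`
            ([set w | X w <= x k.+1] `&` [set w | Y w <= x k.+1]).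
  have mF : measurable F by apply: measurableD; apply: measurableI; exact: mle.
  have PF : fine (P F) = q * r ^+ k.+1.
    rewrite measureD; [|by apply: measurableI; exact: mle|by apply: measurableI; exact: mle|].
      have -> : ([set w | X w <= x k] `&` [set w | Y w <= x k.+1]) `&`
          ([set w | X w <= x k.+1] `&` [set w | Y w <= x k.+1]) =
          [set w | X w <= x k.+1] `&` [set w | Y w <= x k.+1].
        by apply/setIidr => w /= [Xw Yw]; split => //; exact: (le_trans Xw (xS k)).
      rewrite [X in (X - _)%E]PXY [X in (_ - X)%E]PXY -EFinB /=
        !expx -!expRM_natl /q -natr1.
      rewrite -!expRD mulrBr mulr1 mulrBl -!expRD.
      congr (expR _ - expR _); rewrite -?natr1; ring.
    by rewrite [X in (X < _)%E]PXY ltry.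
  rewrite -PF addrC -fineD ?fin_num_measure// -measureU//; last first.
    apply/seteqP; split => w //= -[[_ nXw] [[Xw _] _]]; exact: (nXw Xw).
  apply: fine_le; rewrite ?fin_num_measure//; try exact: measurableU.
  apply: le_measure; rewrite ?inE//; first exact: measurableU.
  move=> w [[YX nXw]|[[Xw Yw] nXYw]]; split => //=.
  - by move=> Xw; apply: nXw; exact: (le_trans Xw (xS k)).
  - by rewrite ltNge; apply/negP => XY; apply: nXYw; split => //=; exact: (le_trans XY Yw).
  - by move=> XS; apply: nXYw.
(* The sum of the terms [q * r ^+ i] for [i] from 1 to [k], multiplied by [1 - r] to avoid a
   division. *)
have sumE k : q * (r - r ^+ k.+1) <= (1 - r) * fine (P (E k)).
  have r1 : 0 <= 1 - r.
    by rewrite subr_ge0 expR_le1 oppr_le0 mulr_ge0 ?addr_ge0 ?ltW.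
  elim: k => [|k IH]; first by rewrite expr1 subrr mulr0 mulr_ge0 ?fine_ge0.
  apply: le_trans (ler_wpM2l r1 (step k)); rewrite [leRHS]mulrDr.
  rewrite -[leLHS](subrK (q * (r - r ^+ k.+1))) lerD//.
  rewrite [leLHS](_ : _ = (1 - r) * (q * r ^+ k.+1))//.
  by rewrite exprS; ring.
apply: le_trans (sumE N) _; apply: ler_wpM2l.
  by rewrite subr_ge0 expR_le1 oppr_le0 mulr_ge0 ?addr_ge0 ?ltW.
apply: fine_le; rewrite ?fin_num_measure//.
by apply: le_measure; rewrite ?inE//; move=> w [].
Qed.

(** * Race among all tokens *)

Lemma measurable_fun_bigmax (R : realType) (d : measure_display) (T : measurableType d)
    (D : set T) (I : Type) (r : seq I) (Q : pred I) (f0 : T -> R) (f : I -> T -> R) :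
  measurable_fun D f0 -> (forall i, measurable_fun D (f i)) ->
  measurable_fun D (fun w => \big[Num.max/f0 w]_(i <- r | Q i) f i w).
Proof.
move=> mf0 mf; elim: r => [|i r IH]; first by under eq_fun do rewrite big_nil.
under eq_fun do rewrite big_cons; case: (Q i) => //.
exact: measurable_realfun.measurable_maxr.
Qed.

Lemma exists_neq (V : finType) (t : V) : (1 < #|V|)%N -> exists j, j != t.
Proof.
move=> /card_gt1P[x [y [_ _ xy]]].
by have [xt|xt] := eqVneq x t; [exists y; rewrite eq_sym -xt|exists x].
Qed.

(** Max-stability of the Gumbel law: the maximum of the shifted competitors has distribution
    function [exp (- b e^-y)], with [b] the sum of their weights, so only two variables race. The
    strict event is bounded below and the weak one above by the same number; any event between the
    two has that probability, however ties are broken. *)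
Lemma gumbel_race (R : realType) (d : measure_display)
    (Omega : measurableType d) (P : probability Omega R) (V : finType)
    (v : V -> {RV P >-> R}) (t : V) (a : V -> R) :
  (1 < #|V|)%N -> (forall j, standard_gumbel (v j)) ->
  mutually_independent P (fun j => sigma_rv (v j)) ->
  (forall j, 0 < a j) ->
  (((1 + \sum_(j | j != t) a j)^-1)%:E
     <= P [set w | forall j, j != t -> (v j w + ln (a j) < v t w)%R])%E /\
  (P [set w | forall j, j != t -> (v j w + ln (a j) <= v t w)%R]
     <= ((1 + \sum_(j | j != t) a j)^-1)%:E)%E.
Proof.
move=> V1 gv iv a0; set b := \sum_(j | _) _.
have [j0 j0t] := @exists_neq V t V1.
have b0 : 0 < b.
  rewrite /b (bigD1 j0)//= ltr_wpDr// sumr_ge0// => j _; exact: ltW.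
(* The initial value of the maximum is one of its own terms, since [j0 != t], and so leaves it
   unchanged. *)
pose Y w := \big[Num.max/v j0 w + ln (a j0)]_(j | j != t) (v j w + ln (a j)).
have YP w y : (Y w <= y) <-> (forall j, j != t -> v j w + ln (a j) <= y).
  split; first by move=> /bigmax_leP[].
  by move=> H; apply/bigmax_leP; split=> //; exact: H.
have YltP w y : (Y w < y) <-> (forall j, j != t -> v j w + ln (a j) < y).
  split; first by move=> /bigmax_ltP[].
  by move=> H; apply/bigmax_ltP; split=> //; exact: H.
have mY : measurable_fun setT Y.
  by apply: measurable_fun_bigmax => [|i]; apply: measurable_funD.
have mv : measurable_fun setT (v t) by [].
have cdfXY x y : P ([set w | v t w <= x] `&` [set w | Y w <= y]) =
    (expR (- (1 * expR (- x))) * expR (- (b * expR (- y))))%:E.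
  (* The joint event is a box with one threshold per token, to which independence applies
     directly. *)
  pose z j := if j == t then x else y - ln (a j).
  have -> : [set w | v t w <= x] `&` [set w | Y w <= y] =
      \bigcap_(j in [set` [set: V]%SET]) (v j @^-1` `]-oo, z j]).
    apply/seteqP; split => w /=.
      move=> [Xw /YP Yw] j _ /=; rewrite in_itv/= /z.
      by case: eqVneq => [->//|jt]; rewrite lerBrDr Yw.
    move=> H; have Hj j : v j w <= z j by have := H j; rewrite /= inE in_itv/=; exact.
    split; first by have := Hj t; rewrite /z eqxx.
    by apply/YP => j jt; have := Hj j; rewrite /z (negPf jt) lerBrDr.
  rewrite iv; last first.
    by move=> j _; exists [set` `]-oo, z j]]; rewrite ?setTI//; exact: measurable_itv.
  under eq_bigr do rewrite [P _](gv _ (z _)).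
  rewrite prodEFin; congr EFin; rewrite (bigD1 t) ?inE//= {1}/z eqxx mul1r; congr (_ * _).
  rewrite -expR_sum; congr expR; rewrite sumrN mulr_suml; congr (- _).
  apply: eq_big => [j|j jt]; first by rewrite inE.
  have {}jt : j != t by move: jt; rewrite inE.
  by rewrite /z (negPf jt) opprB expRD lnK// posrE.
have race : ((1 / (1 + b))%:E <= P [set w | (Y w < v t w)%R])%E.
  exact: exp_race_lower cdfXY.
(* With the roles exchanged, the lower bound concerns the complement of the weak event, hence the
   upper bound [1 - b / (b + 1)]. *)
have race' : ((b / (b + 1))%:E <= P [set w | (v t w < Y w)%R])%E.
  apply: exp_race_lower => // y x; rewrite setIC cdfXY; congr EFin.
  by rewrite mulrC.
split.
  rewrite -div1r; have -> : [set w | forall j, j != t -> v j w + ln (a j) < v t w] =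
      [set w | Y w < v t w] by apply/seteqP; split=> w /= /YltP.
  exact: race.
have mXY : measurable [set w | v t w < Y w] by exact: measurable_set_lt.
have -> : [set w | forall j, j != t -> v j w + ln (a j) <= v t w] = ~` [set w | v t w < Y w].
  apply/seteqP; split=> w /=; first by move=> /YP; rewrite leNgt => /negP.
  by move=> /negP; rewrite -leNgt => /YP.
rewrite probability_setC//.
rewrite leeBlDr ?fin_num_measure//.
apply: le_trans (leeD2l _ race'); rewrite -EFinD lee_fin.
by rewrite addrC le_eqVlt; apply/orP; left; apply/eqP; field; lra.
Qed.

(** * The Gumbel-Max output as a race *)

(** Together with [gumbel_max_ltP], this encloses the event of output [t] between the strict and the
    weak race with shifts [ln (D j / D t)]; positivity of [D] keeps all logarithms finite. *)
Lemma gumbel_max_leP (R : realType) (V : finType) (V_gt1 : (1 < #|V|)%N)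
    (D : fdist R V) (u : V -> R) (t : V) : (forall j, 0 < D j) ->
  gumbel_max V_gt1 D u = t -> forall j, u j + ln (D j / D t) <= u t.
Proof.
move=> D0; rewrite /gumbel_max; case: Order.TotalTheory.arg_maxP => // i _ H <- j.
have := H j isT; rewrite !lne_EFin// -!EFinD /Order.ge/= lee_fin ln_div ?posrE//.
lra.
Qed.

Lemma gumbel_max_ltP (R : realType) (V : finType) (V_gt1 : (1 < #|V|)%N)
    (D : fdist R V) (u : V -> R) (t : V) : (forall j, 0 < D j) ->
  (forall j, j != t -> u j + ln (D j / D t) < u t) -> gumbel_max V_gt1 D u = t.
Proof.
move=> D0 H; apply/eqP; apply: contraT => /H; rewrite ltNge => /negP[].
rewrite ln_div ?posrE//.
rewrite /gumbel_max; case: Order.TotalTheory.arg_maxP => // i _ /(_ t isT).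
rewrite !lne_EFin// -!EFinD /Order.ge/= lee_fin; lra.
Qed.

Lemma measurable_finType_preimage (d : measure_display)
    (T : measurableType d) (I : finType) (f : T -> I) (A : pred I) :
  (forall i, measurable (f @^-1` [set i])) -> measurable [set w | A (f w)].
Proof.
move=> mf; have -> : [set w | A (f w)] = \bigcup_(i in [set i | A i]) f @^-1` [set i].
  by apply/seteqP; split => [w Aw|w [i /[swap] /= <-]//]; exists (f w).
by apply: fin_bigcup_measurable => //; exact: finite_finset.
Qed.

Lemma measurable_gumbel_max (R : realType) (V : finType) (V_gt1 : (1 < #|V|)%N)
    (D : fdist R V) (d : measure_display) (T : measurableType d)
    (u : V -> T -> R) (A : pred V) :
  (forall j, 0 < D j) -> (forall j, measurable_fun setT (u j)) ->
  measurable [set w | A (gumbel_max V_gt1 D (fun j => u j w))].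
Proof.
move=> D0 mu.
(* The argmax is a function of the finite table of pairwise comparisons. *)
pose b w := [ffun ij : V * V => u ij.1 w + ln (D ij.1) <= u ij.2 w + ln (D ij.2)].
pose g (b : {ffun V * V -> bool}) :=
  odflt (some_token V_gt1) [pick i | [forall j, b (j, i)]].
have gb w : gumbel_max V_gt1 D (fun j => u j w) = g (b w).
  rewrite /gumbel_max /Order.arg_max /extremum /g; congr odflt; apply: eq_pick => i /=.
  apply: eq_forallb => j; rewrite ffunE /= !(leNgt _ 0) !D0 /= -!EFinD lee_fin.
  by rewrite !(addrC (ln _)).
under eq_set do rewrite gb.
apply: (@measurable_finType_preimage _ _ _ b (fun c => A (g c))) => c.
have -> : b @^-1` [set c] = \bigcap_(ij in setT)
    [set w | (u ij.1 w + ln (D ij.1) <= u ij.2 w + ln (D ij.2)) = c ij].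
  apply/seteqP; split => [w <- ij _|w H] /=; first by rewrite /b ffunE.
  by apply/ffunP => ij; rewrite ffunE; exact: H.
apply: fin_bigcap_measurable => [|ij _]; first exact: finite_finset.
have m : measurable [set w | u ij.1 w + ln (D ij.1) <= u ij.2 w + ln (D ij.2)].
  by apply: measurable_set_le; exact: measurable_funD.
case: (c ij) => //.
rewrite (_ : [set w | _] = ~` [set w | u ij.1 w + ln (D ij.1) <= u ij.2 w + ln (D ij.2)]).
  exact: measurableC.
by apply/seteqP; split => w /=; [move=> -> | move/negP/negbTE].
Qed.

Lemma measurable_gumbel_max_eq (R : realType) (V : finType) (V_gt1 : (1 < #|V|)%N)
    (D : fdist R V) (d : measure_display) (T : measurableType d)
    (u : V -> T -> R) (t : V) :
  (forall j, 0 < D j) -> (forall j, measurable_fun setT (u j)) ->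
  measurable [set w | gumbel_max V_gt1 D (fun j => u j w) = t].
Proof.
move=> D0 mu; have := @measurable_gumbel_max R V V_gt1 D d T u (pred1 t) D0 mu.
by congr measurable; apply/seteqP; split => w /= /eqP.
Qed.

Lemma fdist_sum_ratio (R : realType) (V : finType) (D : fdist R V) (t : V) : 0 < D t ->
  1 + \sum_(j | j != t) D j / D t = (D t)^-1.
Proof.
move=> Dt; rewrite -mulr_suml; have := fdist_sum1 D; rewrite (bigD1 t)//=.
by move=> /(canRL (addKr _)) ->; field; rewrite gt_eqF.
Qed.

(** Both race bounds equal [D t], because the weights [D j / D t], including 1 for [t] itself, add
    up to [1 / D t]. *)
Lemma gumbel_max_prob (R : realType) (d : measure_display)
    (Omega : measurableType d) (P : probability Omega R) (V : finType)
    (V_gt1 : (1 < #|V|)%N) (v : V -> {RV P >-> R}) (D : fdist R V) (t : V) :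
  (forall j, standard_gumbel (v j)) ->
  mutually_independent P (fun j => sigma_rv (v j)) ->
  (forall j, 0 < D j) ->
  P [set w | gumbel_max V_gt1 D (fun j => v j w) = t] = (D t)%:E.
Proof.
move=> gv iv D0.
have a0 j : 0 < D j / D t by rewrite divr_gt0.
have [lo hi] := @gumbel_race _ _ _ _ _ v t _ V_gt1 gv iv a0.
rewrite fdist_sum_ratio// invrK in lo hi.
have mG : measurable [set w | gumbel_max V_gt1 D (fun j => v j w) = t].
  exact: measurable_gumbel_max_eq.
have mA (le : rel R) : (le = <=%R) \/ (le = <%R) ->
    measurable [set w | forall j, j != t -> le (v j w + ln (D j / D t)) (v t w)].
  move=> lE; rewrite (_ : [set w | _] = \bigcap_(j in [set j | j != t])
    [set w | le (v j w + ln (D j / D t)) (v t w)])//.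
  apply: fin_bigcap_measurable => [|j _]; first exact: finite_finset.
  case: lE => ->.
    by apply: measurable_set_le => //; exact: measurable_funD.
  by apply: measurable_set_lt => //; exact: measurable_funD.
apply/eqP; rewrite eq_le; apply/andP; split.
  apply: le_trans hi; apply: le_measure; rewrite ?inE//; first by apply: mA; left.
  by move=> w /= H j _; exact: (@gumbel_max_leP _ _ V_gt1 D (fun j => v j w) t D0 H).
apply: (le_trans lo); apply: le_measure; rewrite ?inE//; first by apply: mA; right.
by move=> w /= H; exact: gumbel_max_ltP.
Qed.

(** When [t] wins against competitors that each take the larger of their two ratios, it wins for [D]
    and for [D']. *)
Lemma gumbel_max_coupling (R : realType) (d : measure_display)
    (Omega : measurableType d) (P : probability Omega R) (V : finType)
    (V_gt1 : (1 < #|V|)%N) (v : V -> {RV P >-> R}) (D D' : fdist R V) (t : V) :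
  (forall j, standard_gumbel (v j)) ->
  mutually_independent P (fun j => sigma_rv (v j)) ->
  (forall j, 0 < D j) -> (forall j, 0 < D' j) ->
  ((D t * D' t)%:E < P ([set w | gumbel_max V_gt1 D (fun j => v j w) = t] `&`
                        [set w | gumbel_max V_gt1 D' (fun j => v j w) = t]))%E.
Proof.
move=> gv iv D0 D'0.
pose a j := Num.max (D j / D t) (D' j / D' t).
have a0 j : 0 < a j by rewrite lt_max divr_gt0.
have [lo _] := @gumbel_race _ _ _ _ _ v t _ V_gt1 gv iv a0.
have mG (D1 : fdist R V) : (forall j, 0 < D1 j) ->
    measurable [set w | gumbel_max V_gt1 D1 (fun j => v j w) = t].
  by move=> D10; exact: measurable_gumbel_max_eq.
have mS : measurable [set w | forall j, j != t -> v j w + ln (a j) < v t w].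
  rewrite (_ : [set w | _] = \bigcap_(j in [set j | j != t])
    [set w | v j w + ln (a j) < v t w])//.
  apply: fin_bigcap_measurable => [|j _]; first exact: finite_finset.
  by apply: measurable_set_lt => //; exact: measurable_funD.
apply: lt_le_trans (le_trans lo _); last first.
  apply: le_measure; rewrite ?inE//; first by apply: measurableI; exact: mG.
  move=> w /= H; split; apply: gumbel_max_ltP => // j jt;
  apply: le_lt_trans (H j jt); rewrite lerD2l;
  by rewrite ler_ln ?posrE ?divr_gt0// le_max lexx ?orbT.
(* In terms of reciprocals, the claim compares [1 + \sum_(j | j != t) a j] with a product
   [(1 + A) * (1 + B)]; it is strict because a second token makes [A * B] positive. *)
rewrite lte_fin -[D t]invrK -[D' t]invrK -invfM ltf_pV2 ?posrE; last 2 first.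
  by rewrite mulr_gt0 ?invr_gt0.
  by rewrite ltr_pwDl// sumr_ge0// => j _; exact: ltW.
rewrite -(fdist_sum_ratio _ _ (D0 t)) -(fdist_sum_ratio _ _ (D'0 t)).
have A0 (D1 : fdist R V) : (forall j, 0 < D1 j) -> 0 < \sum_(j | j != t) D1 j / D1 t.
  move=> D10; have [j jt] := @exists_neq V t V_gt1.
  rewrite (bigD1 j)//= ltr_pwDl ?divr_gt0// sumr_ge0// => k _; rewrite ltW ?divr_gt0//.
have : \sum_(j | j != t) a j <=
    \sum_(j | j != t) D j / D t + \sum_(j | j != t) D' j / D' t.
  rewrite -big_split/=; apply: ler_sum => j _.
  by rewrite ge_max lerDl lerDr !ltW ?divr_gt0.
have := mulr_gt0 (A0 _ D0) (A0 _ D'0).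
rewrite mulrDl mul1r mulrDr mulr1; lra.
Qed.

(** * Variance of a difference of indicators, and conditioning on the prompt *)

(** Isolates [P (A]&[B)], the one term in which shared and independent noise will differ. *)
Lemma variance_indicB (R : realType) (d : measure_display)
    (Omega : measurableType d) (P : probability Omega R) (A B : set Omega) :
  measurable A -> measurable B ->
  'V_P[(\1_A \- \1_B : Omega -> R)] =
  (fine (P A) * (1 - fine (P A)) + fine (P B) * (1 - fine (P B))
   - 2 * (fine (P (A `&` B)) - fine (P A) * fine (P B)))%:E.
Proof.
move=> mA mB.
(* Square integrability: an indicator is bounded by 1 and [P] has total mass 1. *)
have L2 (C : set Omega) : measurable C -> (\1_C : Omega -> R) \in Lfun P 2%:E.
  move=> mC; rewrite inE; apply/andP; split; rewrite inE/=; first exact: measurable_indic.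
  rewrite /finite_norm unlock poweR_lty//.
  apply: (@le_lt_trans _ _ (\int[P]_x (cst 1 x))%E); last first.
    by rewrite integral_cst// mul1e [X in (X < _)%E]probability_setT ltry.
  apply: ge0_le_integral => //.
  - by move=> x _; rewrite lee_fin powR_ge0.
  - apply/measurable_EFinP; apply: (measurableT_comp (measurable_powR _)) => //.
    by apply: measurableT_comp => //; exact: measurable_indic.
  - move=> x _ /=; rewrite lee_fin indicE.
    by case: (_ \in _); rewrite ?normr1 ?normr0 ?powR1 ?powR0// ler01.
have L1 (C : set Omega) : measurable C -> (\1_C : Omega -> R) \in Lfun P 1.
  by move=> mC; apply: Lfun_subset12; [rewrite fin_num_measure|exact: L2].
have cov (C D : set Omega) : measurable C -> measurable D ->
   covariance P (\1_C) (\1_D) = (fine (P (C `&` D)) - fine (P C) * fine (P D))%:E.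
  move=> mC mD; have CD : (\1_C * \1_D : Omega -> R) = \1_(C `&` D).
    by rewrite indicI.
  rewrite covarianceE ?CD ?L1//; last exact: measurableI.
  rewrite !expectation_indic//; last exact: measurableI.
  by rewrite EFinB EFinM !fineK ?fin_num_measure//; exact: measurableI.
rewrite varianceB ?L2//.
rewrite /variance !cov// !setIid (_ : (2 : \bar R)%E = 2%:E)//.
rewrite -[X in (_ - X)%E]EFinM -[X in (X - _)%E]EFinD -EFinB.
by congr EFin; ring.
Qed.
(** The finitely many values of [S] partition [Omega]; this turns an event at the random prompt into
    events at fixed prompts. *)
Lemma prompt_mixture (R : realType) (d : measure_display)
    (Omega : measurableType d) (P : probability Omega R) (T : finType)
    (S : Omega -> T) (E : T -> set Omega) :
  (forall s, measurable (S @^-1` [set s])) -> (forall s, measurable (E s)) ->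
  measurable [set w | E (S w) w] /\
  fine (P [set w | E (S w) w]) = \sum_s fine (P (S @^-1` [set s] `&` E s)).
Proof.
move=> mS mE.
have UE : [set w | E (S w) w] = \bigcup_(s in [set` index_enum T]) (S @^-1` [set s] `&` E s).
  apply/seteqP; split => [w Ew|w [s _ [/= <-]]//].
  by exists (S w) => //=; rewrite mem_index_enum.
rewrite UE; split.
  by apply: fin_bigcup_measurable => [|s _]; [exact: finite_finset|exact: measurableI].
rewrite measure_fin_bigcup.
- rewrite -fsbig_seq ?index_enum_uniq// -sum_fine// => s _.
  by rewrite fin_num_measure//; exact: measurableI.
- exact: finite_finset.
- by move=> s s' _ _ [w [[/= <- _] [/= <- _]]].
- by move=> s _; exact: measurableI.
Qed.

Lemma single_token_inj (V : finType) (K : nat) : injective (@single_token V K).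
Proof. by move=> x y /(congr1 val) []. Qed.

Lemma single_token_model_gt0 (R : realType) (V : finType) (K : nat)
    (m : llm R V K) : single_token_model m -> forall s t, 0 < m s t.
Proof.
move=> [m0 _] s t; have := m0 s t; rewrite /output_prob (big_pred1 t)// => t'.
exact: (inj_eq (@single_token_inj V K)).
Qed.

(** [measurable_gumbel_max] is applied on [Omega] with the sigma-algebra generated by the noise,
    which puts the event in the family that the independence hypothesis speaks of. *)
Lemma sigma_rvs_gumbel_max (R : realType) (d : measure_display)
    (Omega : measurableType d) (V : finType) (V_gt1 : (1 < #|V|)%N)
    (I : Type) (U : I -> V -> Omega -> R) (D : fdist R V) (i : I) (A : pred V) :
  (forall j, 0 < D j) ->
  sigma_rvs (fun it : I * V => U it.1 it.2)
    [set w | A (gumbel_max V_gt1 D (fun j => U i j w))].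
Proof.
move=> D0.
apply: (@measurable_gumbel_max _ _ V_gt1 D _
  (g_sigma_algebraType (\bigcup_(it : I * V) sigma_rv (U it.1 it.2)))
  (fun j => U i j) A D0) => j _ Y mY.
by apply: sub_sigma_algebra; exists (i, j) => //; exists Y.
Qed.

Lemma prompt_noises_indep (R : realType) (d : measure_display)
    (Omega : measurableType d) (P : probability Omega R) (V : finType) (K : nat)
    (S : Omega -> token_seq V K) (U U' : 'I_K.+1 -> V -> {RV P >-> R})
    (s : token_seq V K) (X Y : set Omega) :
  independent_prompt_noises S U U' ->
  sigma_rvs (fun it : 'I_K.+1 * V => U it.1 it.2) X ->
  sigma_rvs (fun it : 'I_K.+1 * V => U' it.1 it.2) Y ->
  P (S @^-1` [set s] `&` (X `&` Y)) = (P (S @^-1` [set s]) * (P X * P Y))%E.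
Proof.
move=> iSUU' sX sY.
pose A (i : 'I_3) := nth set0 [:: S @^-1` [set s]; X; Y] i.
have -> : S @^-1` [set s] `&` (X `&` Y) = \bigcap_(i in [set` [set: 'I_3]%SET]) A i.
  apply/seteqP; split => [w [Sw [Xw Yw]] [[|[|[|//]]] ?] _ //|w H].
  have Hi i : A i w by apply: H; rewrite /= inE.
  by split; [exact: (Hi 0)|split; [exact: (Hi 1)|exact: (Hi 2)]].
rewrite iSUU'.
  rewrite (eq_bigl xpredT) => [|i]; last by rewrite inE.
  by rewrite !big_ord_recl big_ord0 mule1.
move=> [[|[|[|//]]] ?] _; rewrite (tnth_nth set0) //=.
by exists [set s] => //; rewrite setTI.
Qed.

(** Allows [setT] for either noise event in [prompt_noises_indep], which leaves the independence of
    the prompt and one noise. *)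
Lemma sigma_rvs_setT (R : realType) (d : measure_display)
    (Omega : measurableType d) (I : Type) (X : I -> Omega -> R) : sigma_rvs X setT.
Proof. exact: (@measurableT _ (g_sigma_algebraType (\bigcup_i sigma_rv (X i)))). Qed.

(** * Comparison of the two variances *)

Theorem proposition3 (R : realType) (V : finType) (V_gt1 : (1 < #|V|)%N)
    (K : nat) (PQ : fdist R (token_seq V K))
    (c : token_seq V K -> {set token_seq V K})
    (c_single : forall s, 0 < PQ s ->
      exists t, c s = [set single_token K t]%SET)
    (m : llm R V K) (m_single : single_token_model m) :
  exists eps : R, 0 < eps /\
    forall m' : llm R V K, single_token_model m' -> dist_llm m m' < eps ->
    forall (d : measure_display) (Omega : measurableType d)
      (P : probability Omega R) (Sq : Omega -> token_seq V K)
      (U U' : 'I_K.+1 -> V -> {RV P >-> R}),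
    prompt_law P PQ Sq -> gumbel_noise U -> gumbel_noise U' ->
    independent_prompt_noises Sq U U' ->
    ('V_P[fun w => (score V_gt1 c m (noise_at U w) (Sq w)
                   - score V_gt1 c m' (noise_at U' w) (Sq w))%R]
     > 'V_P[fun w => (score V_gt1 c m (noise_at U w) (Sq w)
                     - score V_gt1 c m' (noise_at U w) (Sq w))%R])%E.
Proof.
exists 1; split=> // m' m'_single _ d Omega P Sq U U' lawS [gU iU _] [gU' iU' _] ind.
have m0 := single_token_model_gt0 m_single.
have m'0 := single_token_model_gt0 m'_single.
pose ok (n : llm R V K) (W : 'I_K.+1 -> V -> {RV P >-> R}) s :=
  [set w | single_token K (output_token V_gt1 n (noise_at W w) s) \in c s].
have scoreE (n : llm R V K) (W : 'I_K.+1 -> V -> {RV P >-> R}) :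
    (fun w => score V_gt1 c n (noise_at W w) (Sq w)) =
    \1_[set w | ok n W (Sq w) w] :> (Omega -> R).
  apply/funext => w; rewrite indicE /score; congr (_%:R); congr nat_of_bool.
  by apply/idP/idP; rewrite inE.
have mS s : measurable (Sq @^-1` [set s]) by have [] := lawS s.
have sok (n : llm R V K) (W : 'I_K.+1 -> V -> {RV P >-> R}) s :
    (forall s t, 0 < n s t) ->
    sigma_rvs (fun it : 'I_K.+1 * V => W it.1 it.2) (ok n W s).
  by move=> n0; exact: (@sigma_rvs_gumbel_max _ _ _ _ V_gt1 _
    (fun i j => W i j : Omega -> R) (n s) ord0 (fun t => single_token K t \in c s)).
have mok (n : llm R V K) (W : 'I_K.+1 -> V -> {RV P >-> R}) s :
    (forall s t, 0 < n s t) -> measurable (ok n W s).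
  by move=> n0; exact: (@measurable_gumbel_max _ _ V_gt1 (n s) _ _
    (fun j => W ord0 j : Omega -> R) (fun t => single_token K t \in c s)).
have okE (n : llm R V K) (W : 'I_K.+1 -> V -> {RV P >-> R}) s t :
    c s = [set single_token K t]%SET ->
    ok n W s = [set w | gumbel_max V_gt1 (n s) (fun j => W ord0 j w) = t].
  move=> cs; apply/seteqP; split => w; rewrite /ok /= cs inE.
    by move=> /eqP /single_token_inj.
  by move=> wt; apply/eqP; congr single_token.
(* The marginals of [m'] agree under both noises: with correct token [t], each conditional
   probability is [m' s t]; prompts of mass zero contribute 0, whatever [c s] is. *)
have PAB s : fine (P (Sq @^-1` [set s] `&` ok m' U s)) =
             fine (P (Sq @^-1` [set s] `&` ok m' U' s)).
  have := prompt_noises_indep s ind (sok m' U s m'0) (sigma_rvs_setT _).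
  have := prompt_noises_indep s ind (sigma_rvs_setT _) (sok m' U' s m'0).
  rewrite setIT setTI probability_setT mule1 mul1e => -> ->.
  have [_ ->] := lawS s; have := fdist_ge0 PQ s; rewrite le_eqVlt => /predU1P[<-|Qs].
    by rewrite !mul0e.
  by have [t cs] := c_single s Qs; rewrite !(okE _ _ _ _ cs) !gumbel_max_prob.
(* Recording the equality case as [PQ s == 0] lets any prompt of positive mass make the summed
   inequality strict. *)
have PAB' s : fine (P (Sq @^-1` [set s] `&` (ok m U s `&` ok m' U' s)))
    <= fine (P (Sq @^-1` [set s] `&` (ok m U s `&` ok m' U s))) ?= iff (PQ s == 0).
  (* Under shared noise the joint event depends on [U] alone, so it factors from the prompt as a
     single event. *)
  have sUU : sigma_rvs (fun it : 'I_K.+1 * V => U it.1 it.2) (ok m U s `&` ok m' U s).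
    exact: (@measurableI _ (g_sigma_algebraType (\bigcup_(it : 'I_K.+1 * V) sigma_rv (U it.1 it.2)))
      _ _ (sok m U s m0) (sok m' U s m'0)).
  have := prompt_noises_indep s ind sUU (sigma_rvs_setT _).
  have := prompt_noises_indep s ind (sok m U s m0) (sok m' U' s m'0).
  rewrite setIT probability_setT mule1 => -> ->.
  have [_ ->] := lawS s; have := fdist_ge0 PQ s; rewrite le_eqVlt => /predU1P[<-|Qs].
    by rewrite !mul0e eqxx; apply/leif_refl.
  rewrite (gt_eqF Qs); have [t cs] := c_single s Qs.
  rewrite !(okE _ _ _ _ cs) !gumbel_max_prob//.
  set E := P (_ `&` _); have finE : E \is a fin_num.
    by rewrite fin_num_measure//; apply: measurableI; rewrite -(okE _ _ _ _ cs); exact: mok.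
  have : ((m s t * m' s t)%:E < E)%E :=
    gumbel_max_coupling V_gt1 (U ord0) (m s) (m' s) t
      (gU ord0) (iU ord0) (m0 s) (m'0 s).
  rewrite -(fineK finE) -!EFinM lte_fin /= => ltE.
  by split; [rewrite ltW ?ltr_pM2l|rewrite lt_eqF ?ltr_pM2l].
have [s0 Qs0] : exists s0, PQ s0 != 0.
  apply/existsP; rewrite -[X in is_true X]negbK negb_exists; apply/negP => /forallP Q0.
  have := fdist_sum1 PQ; rewrite big1 => [/eqP|s _]; last first.
    by apply/eqP; have := Q0 s; rewrite negbK.
  by rewrite eq_sym oner_eq0.
have mix (E : token_seq V K -> set Omega) (mE : forall s, measurable (E s)) :=
  @prompt_mixture _ _ _ P _ Sq E mS mE.
have [mA _] := mix (ok m U) (fun s => mok m U s m0).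
have [mB PB] := mix (ok m' U) (fun s => mok m' U s m'0).
have [mB' PB'] := mix (ok m' U') (fun s => mok m' U' s m'0).
have [_ PAB1] := mix _ (fun s => measurableI _ _ (mok m U s m0) (mok m' U s m'0)).
have [_ PAB1'] := mix _ (fun s => measurableI _ _ (mok m U s m0) (mok m' U' s m'0)).
have varE (W : 'I_K.+1 -> V -> {RV P >-> R})
    (mW : measurable [set w | ok m' W (Sq w) w]) :=
  @variance_indicB _ _ _ P _ _ mA mW.
have fE (W : 'I_K.+1 -> V -> {RV P >-> R}) :
  (fun w => score V_gt1 c m (noise_at U w) (Sq w)
    - score V_gt1 c m' (noise_at W w) (Sq w)) =
  (\1_[set w | ok m U (Sq w) w] \- \1_[set w | ok m' W (Sq w) w] : Omega -> R).
  by apply/funext => w /=; rewrite -(scoreE m U) -(scoreE m' W).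
(* Once the marginal terms coincide and cancel, the larger joint probability gives the smaller
   variance. *)
rewrite !fE varE// varE// lte_fin PB PB' (eq_bigr _ (fun s _ => PAB s)).
rewrite ltrD2l ltrN2 ltr_pM2l// ltrD2r.
(* The intersection of the two events at the random prompt is convertible to the event in the
   [prompt_mixture] identity. *)
rewrite (PAB1 : fine (P ([set w | ok m U (Sq w) w] `&` [set w | ok m' U (Sq w) w])) = _).
rewrite (PAB1' : fine (P ([set w | ok m U (Sq w) w] `&` [set w | ok m' U' (Sq w) w])) = _).
rewrite (bigD1 s0)//= [ltRHS](bigD1 s0)//= ltr_leD//.
  by have [leAB eqAB] := PAB' s0; rewrite lt_neqAle eqAB Qs0.
by apply: ler_sum => s _; exact: (PAB' s).
Qed.
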